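(* For every (finite, simple) graph $G$ with treewidth $tw(G)\leq 2$ we have $b(G)\leq 2$, i.e., $G$ is a $2$-bend graph.
   Context: An EPG representation of a simple graph $G$ is an assignment of a finite path $P(u)$ in the rectangular plane grid (a sequence of consecutive grid edges, not self-intersecting in grid edges) to every vertex $u$ of $G$, such that for distinct $u,v$, the paths $P(u)$ and $P(v)$ share at least one grid edge if and only if $\{u,v\}\in E(G)$ (intersections only at grid vertices do not count). A bend of a path is a horizontal grid edge followed by a vertical one, or a vertical one followed by a horizontal one. $G$ is a $k$-bend graph if it has an EPG representation in which every path has at most $k$ bends. The bend-number $b(G)$ is the minimum $k$ such that $G$ is a $k$-bend graph. *)

(* Defs.v *)
From HB Require Import structures.
From mathcomp Require Import all_boot all_order all_algebra.

Set Implicit Arguments.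
Unset Strict Implicit.
Unset Printing Implicit Defensive.

Import Order.TTheory GRing.Theory Num.Theory.

Definition is_least (P : nat -> Prop) (k : nat) : Prop :=
  P k /\ forall j, P j -> k <= j.

Record sgraph := SGraph {
  svertex :> finType;
  sedge : rel svertex;
  sedge_sym : symmetric sedge;
  sedge_irrefl : irreflexive sedge
}.

Arguments sedge {s} : rename.

(* [ucycle] also accepts [::] and, for each edge xy, [:: x; y]; these are not
   graph-theoretic cycles, hence the bound on the size. *)
Definition is_tree (D : sgraph) : Prop :=
  [/\ 0 < #|D|,
      forall x y : D, connect sedge x y
    & forall c : seq D, ucycle sedge c -> size c < 3].

Definition tree_decomposition (G D : sgraph) (B : D -> {set G}) : Prop :=
  [/\ is_tree D,
      forall v : G, exists i, v \in B i,
      forall u v : G, sedge u v -> exists i, (u \in B i) && (v \in B i)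
    & forall (v : G) (i j : D), v \in B i -> v \in B j ->
        connect [rel a b : D | [&& sedge a b, v \in B a & v \in B b]] i j].

(* The predecessor is truncated: for the graph without vertices the width is
   0 rather than -1. *)
Definition width (G D : sgraph) (B : D -> {set G}) : nat :=
  (\max_(i : D) #|B i|).-1.

Definition has_decomposition_of_width (G : sgraph) (k : nat) : Prop :=
  exists (D : sgraph) (B : D -> {set G}), tree_decomposition B /\ width B = k.

Definition is_treewidth (G : sgraph) : nat -> Prop :=
  is_least (has_decomposition_of_width G).

Definition point : Type := (int * int)%type.

Definition horizontal (s : point * point) : bool :=
  (s.1.2 == s.2.2) && (`|s.1.1 - s.2.1| == 1)%R.

Definition vertical (s : point * point) : bool :=
  (s.1.1 == s.2.1) && (`|s.1.2 - s.2.2| == 1)%R.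

Definition is_grid_edge (s : point * point) : bool :=
  horizontal s || vertical s.

(* A grid edge is a pair of adjacent points, taken up to orientation. *)
Definition same_edge (s t : point * point) : bool :=
  (s == t) || (s == (t.2, t.1)).

Definition consecutive (A : Type) (p : seq A) : seq (A * A) :=
  zip p (behead p).

(* Paths are given by the list of visited points, so that [consecutive p] is
   the list of traversed edges. A point may be visited several times, an edge
   may not, in either direction; a path has at least one edge. *)
Definition grid_path (p : seq point) : bool :=
  [&& 1 < size p,
      all is_grid_edge (consecutive p)
    & pairwise (fun s t => ~~ same_edge s t) (consecutive p)].

Definition share_edge (p q : seq point) : bool :=
  has (fun s => has (same_edge s) (consecutive q)) (consecutive p).

Definition is_bend (st : (point * point) * (point * point)) : bool :=
  horizontal st.1 && vertical st.2 || vertical st.1 && horizontal st.2.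

Definition bends (p : seq point) : nat :=
  count is_bend (consecutive (consecutive p)).

Definition epg_representation (G : sgraph) (P : G -> seq point) : Prop :=
  (forall u, grid_path (P u)) /\
  (forall u v, u != v -> share_edge (P u) (P v) = sedge u v).

Definition bend_graph (k : nat) (G : sgraph) : Prop :=
  exists P : G -> seq point,
    epg_representation P /\ forall u, bends (P u) <= k.

Definition is_bend_number (G : sgraph) : nat -> Prop :=
  is_least (fun k => bend_graph k G).

(* Main.v *)
Require Import Defs.
From HB Require Import structures.
From mathcomp Require Import all_boot all_order all_algebra.
From mathcomp Require Import zify.
From Stdlib Require Import Classical.

(* The vertices are placed one at a time along a traversal of the decomposition tree, so that
   the placed vertices in a bag with the new vertex w are at most two, u and v. All paths
   have the shape horizontal-vertical-horizontal, or the transpose; paths may cross freely,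
   and refining the grid makes fresh lines available. Call a grid edge owned by the set of
   vertices whose paths contain it. The invariant is that each vertex is the only owner of
   some edge and that every pair u, v in a common bag has one of
   - edges owned by u alone and by v alone that are parallel and face each other;
   - edges owned by u alone and by v alone that are perpendicular, and an edge owned by
     exactly {u, v}.
   If some edge is owned by exactly the prescribed neighbours of w among u, v, then w starts
   with a piece of that edge and uses fresh lines to run opposite to the edges owned by
   u alone and by v alone, which gives displays of the first kind for uw and vw. Otherwise
   uv is of the first kind and w is adjacent to both: w joins the two facing edges by a
   perpendicular segment, which gives displays of the second kind. *)

Set Implicit Arguments.
Unset Strict Implicit.
Unset Printing Implicit Defensive.

Import Order.TTheory GRing.Theory Num.Theory.

Local Open Scope ring_scope.

(** * Polylines with at most two bends, and refinement of the grid by the factor 4 *)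

Definition between (a c p : int) : bool :=
  (a <= p) && (p < c) || (c <= p) && (p < a).

(* The polyline (a, b), (c, b), (c, d), (e, d), transposed if [zor] holds. *)
Record zpath :=
  ZPath { zor : bool; za : int; zb : int; zc : int; zd : int; ze : int }.

(* [o], [l], [p] encode the grid edge from p to p + 1 on line l, vertical iff [o]. *)
Definition covers (Q : zpath) (o : bool) (l p : int) : bool :=
  if o == zor Q then
    (l == zb Q) && between (za Q) (zc Q) p || (l == zd Q) && between (zc Q) (ze Q) p
  else (l == zc Q) && between (zb Q) (zd Q) p.

(** Distinct lines for the outer pieces make the middle piece nonempty and prevent an edge from
    being traversed twice. *)
Definition proper_zpath (Q : zpath) : bool := zb Q != zd Q.

Definition touch (Q R : zpath) : Prop :=
  exists o l p, covers Q o l p && covers R o l p.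

Definition scale4 (Q : zpath) : zpath :=
  ZPath (zor Q) (4 * za Q) (4 * zb Q) (4 * zc Q) (4 * zd Q) (4 * ze Q).

Lemma touch_sym Q R : touch Q R -> touch R Q.
Proof. by case=> o [l [p /andP[cQ cR]]]; exists o, l, p; rewrite cQ cR. Qed.

Lemma proper_scale4 Q : proper_zpath Q -> proper_zpath (scale4 Q).
Proof. rewrite /proper_zpath /=; lia. Qed.

(** Corners of a scaled polyline have coordinates divisible by 4, so the four pieces of an old edge
    are covered together or not at all. *)
Lemma covers_scale4 Q o l p i : 0 <= i < 4 ->
  covers (scale4 Q) o (4 * l) (4 * p + i) = covers Q o l p.
Proof.
by rewrite /covers /between /= => ?; case: (o == zor Q); lia.
Qed.

Lemma covers_scale4_line Q o l p : covers (scale4 Q) o l p -> exists k, l = 4 * k.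
Proof.
rewrite /covers /=; case: (o == zor Q).
  by case/orP=> /andP[/eqP-> _]; [exists (zb Q) | exists (zd Q)].
by case/andP=> /eqP-> _; exists (zc Q).
Qed.

Lemma covers_scale4_fresh Q o l p : (forall k, l <> 4 * k) ->
  covers (scale4 Q) o l p = false.
Proof. by move=> fr; apply/negP=> /covers_scale4_line[k /fr]. Qed.

Lemma touch_scale4 Q R : touch (scale4 Q) (scale4 R) <-> touch Q R.
Proof.
split=> [] [o [l [p /andP[cQ cR]]]].
  have [k El] := covers_scale4_line cQ; subst l.
  have [q [i [Ep lt_i]]] : exists q i, p = 4 * q + i /\ 0 <= i < 4.
    by exists (divz p 4), (modz p 4); lia.
  by exists o, k, q; move: cQ cR; rewrite Ep !covers_scale4 // => -> ->.
by exists o, (4 * l), (4 * p); rewrite -[4 * p]addr0 !covers_scale4 // cQ cR.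
Qed.

(* Scaling by 4 makes room: the new path uses the piece [4 * r + 1] of line [b], then two
   fresh lines, and no edge [4 * p] of an old line, so that every old owner keeps its edge. *)
Lemma attach (o : bool) (b r : int) (t : bool -> int) : (exists k, b = 2 * k) ->
  exists W, [/\ proper_zpath W,
    forall o' l p, covers W o' (4 * l) (4 * p) = false,
    forall Q, touch (scale4 Q) W <-> covers (scale4 Q) o b (4 * r + 1)
  & forall o', exists l, (forall k, l <> 4 * k) /\ covers W o' l (4 * t o')].
Proof.
move=> [k Eb].
pose p := t o; pose q := t (~~ o).
(* Being odd, [d] is neither an old line nor the even [b]; its side of [4 * q] makes the middle
   piece cover that position. Likewise [e] makes the last piece cover [4 * p]. *)
pose d := if b <= 4 * q then 4 * q + 1 else 4 * q - 1.
pose e := if r < p then 4 * p + 1 else 4 * p.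
exists (ZPath o (4 * r + 1) b (4 * r + 2) d e); split.
- by rewrite /proper_zpath /d /=; case: ifP; lia.
- move=> o' l s; rewrite /covers /between /= /d /e.
  by case: (o' == o); do ?[case: ifP => ?]; lia.
- move=> Q; split=> [[o' [l [s /andP[cQ]]]] | cQ].
    have [m El] := covers_scale4_line cQ.
    rewrite /covers /between /=; case: eqP => [Eo | _].
      case/orP=> /andP[/eqP El' cW].
        have Es : s = 4 * r + 1 by lia.
        by rewrite -Eo -El' -Es.
      by exfalso; move: El'; rewrite El /d; case: ifP; lia.
    by case/andP=> /eqP El' _; exfalso; lia.
  exists o, b, (4 * r + 1); rewrite cQ /covers eqxx /= eqxx /between; lia.
move=> o'; case: (eqVneq o' o) => [-> | /eqP neq_o].
  exists d; split; first by rewrite /d; case: ifP; lia.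
  by rewrite /covers /= eqxx eqxx /between /e -/p; apply/orP; right; case: ifP; lia.
have -> : o' = ~~ o by move: neq_o; case: (o); case: (o').
exists (4 * r + 2); split; first by lia.
rewrite /covers /=; case: eqP => [|_]; first by case: (o).
by rewrite eqxx /between /d -/q; case: ifP; lia.
Qed.

(** The path is a U: short pieces of the lines [4 * l1] and [4 * l2], joined along the line
    [4 * p + 2], on which no scaled path runs. So contacts occur only on the two short pieces. *)
Lemma bridge (o : bool) (l1 l2 p : int) : l1 <> l2 ->
  exists W, [/\ proper_zpath W,
    forall o' l s, covers W o' (4 * l) (4 * s) = false,
    forall Q, touch (scale4 Q) W <-> covers Q o l1 p || covers Q o l2 p,
    covers W o (4 * l1) (4 * p + 1) && covers W o (4 * l2) (4 * p + 1)
  & exists l s, (forall k, l <> 4 * k) /\ covers W (~~ o) l s].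
Proof.
move=> neq_l; pose c := 4 * p + 2; pose a := 4 * p + 1.
exists (ZPath o a (4 * l1) c (4 * l2) a); split.
- by rewrite /proper_zpath /=; lia.
- by move=> o' l s; rewrite /covers /between /= /a /c; case: (o' == o); lia.
- move=> Q; split=> [[o' [l [s /andP[cQ]]]] | cQ].
    have [m El] := covers_scale4_line cQ.
    rewrite {1}/covers /between /=; case: eqP => [Eo | _].
      rewrite /a /c => cW.
      have Es : s = 4 * p + 1 by lia.
      have [Em | Em] : m = l1 \/ m = l2 by lia.
        by move: cQ; rewrite El Es covers_scale4 // Em -Eo => ->.
      by move: cQ; rewrite El Es covers_scale4 // Em -Eo => ->; rewrite orbT.
    by case/andP=> /eqP El' _; exfalso; rewrite /c in El'; lia.
  case/orP: cQ => cQ; [exists o, (4 * l1), a | exists o, (4 * l2), a];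
    by rewrite covers_scale4 // cQ /covers /between /= /a /c eqxx eqxx; lia.
- by rewrite /covers /between /= /a /c !eqxx; lia.
exists c, (if l1 < l2 then 4 * l1 else 4 * l2); split; first by rewrite /c; lia.
rewrite /covers /=; case: eqP => [|_]; first by case: (o).
by rewrite eqxx /between; case: ifP; lia.
Qed.

(** * Displays and the insertion of one path *)

Definition owned (T : finType) (P : T -> zpath) (S : {set T}) (A : pred T)
    (o : bool) (l p : int) : Prop :=
  forall x, x \in S -> covers (P x) o l p = A x.

(* A display of a pair is what allows a new path to be added next to both, whatever
   its adjacencies to the two. *)
Definition parallel_display (T : finType) (P : T -> zpath) (S : {set T}) (u v : T) :=
  exists o l1 l2 p, owned P S (pred1 u) o l1 p /\ owned P S (pred1 v) o l2 p.

Definition crossing_display (T : finType) (P : T -> zpath) (S : {set T}) (u v : T) :=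
  exists o l1 p1 l2 p2,
    [/\ owned P S (pred1 u) o l1 p1, owned P S (pred1 v) (~~ o) l2 p2
      & exists o3 l3 p3, owned P S (pred2 u v) o3 l3 p3].

Definition display (T : finType) (P : T -> zpath) (S : {set T}) (u v : T) :=
  parallel_display P S u v \/ crossing_display P S u v.

Lemma display_sym (T : finType) (P : T -> zpath) (S : {set T}) u v :
  display P S u v -> display P S v u.
Proof.
case=> [[o [l1 [l2 [p [uP vP]]]]] | [o [l1 [p1 [l2 [p2 [uP vP [o3 [l3 [p3 uvP]]]]]]]]]].
  by left; exists o, l2, l1, p.
right; exists (~~ o), l2, p2, l1, p1; rewrite negbK; split=> //.
by exists o3, l3, p3 => x /uvP->; rewrite /= orbC.
Qed.

(** In use, [H] relates vertices in a common bag and [E] is the adjacency realised so far; outside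
    [S] the values of [P] are placeholders. Sole ownership is demanded separately because a new
    vertex may share its bag with just one placed vertex. *)
Definition represents (T : finType) (P : T -> zpath) (S : {set T}) (H E : rel T) :=
  [/\ forall x, proper_zpath (P x),
      {in S &, forall x y, x != y -> touch (P x) (P y) <-> E x y},
      {in S &, forall x y, x != y -> H x y -> display P S x y}
    & {in S, forall x, exists o l p, owned P S (pred1 x) o l p}].

Definition add_path (T : finType) (P : T -> zpath) (w : T) (W : zpath) (x : T) :=
  if x == w then W else scale4 (P x).

Section AddPath.

Variables (T : finType) (P : T -> zpath) (S : {set T}) (w : T) (W : zpath).
Hypothesis w_notin : w \notin S.
Hypothesis W_avoids : forall o l p, covers W o (4 * l) (4 * p) = false.

Local Notation P' := (add_path P w W).

Lemma add_path_new : P' w = W.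
Proof. by rewrite /add_path eqxx. Qed.

Lemma add_path_old x : x \in S -> P' x = scale4 (P x).
Proof. by rewrite /add_path; case: eqP => // ->; rewrite (negPf w_notin). Qed.

Lemma owned_add_path A o l p i : 0 <= i < 4 -> owned P S A o l p ->
  covers W o (4 * l) (4 * p + i) = A w -> owned P' (w |: S) A o (4 * l) (4 * p + i).
Proof.
move=> lt_i AP Aw x /setU1P[-> | xS]; first by rewrite add_path_new.
by rewrite add_path_old // covers_scale4 // AP.
Qed.

(** Of the four pieces of an old edge the new path leaves the first one free, so that piece keeps
    its owners. *)
Lemma owned_add_path_old A o l p : owned P S A o l p -> A w = false ->
  owned P' (w |: S) A o (4 * l) (4 * p).
Proof.
move=> AP Aw; rewrite -[4 * p]addr0; apply: owned_add_path => //.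
by rewrite addr0 W_avoids.
Qed.

Lemma owned_add_path_new o l p : (forall k, l <> 4 * k) -> covers W o l p ->
  owned P' (w |: S) (pred1 w) o l p.
Proof.
move=> fresh_l cW x /setU1P[-> | xS]; first by rewrite add_path_new cW /= eqxx.
rewrite add_path_old // covers_scale4_fresh //=.
by apply/esym/eqP=> xw; rewrite xw (negPf w_notin) in xS.
Qed.

Lemma old_neq_new x : x \in S -> (w == x) = false.
Proof. by move=> xS; apply/eqP=> wx; move: w_notin; rewrite wx xS. Qed.

Lemma display_add_path u v : u \in S -> v \in S -> display P S u v ->
  display P' (w |: S) u v.
Proof.
move=> uS vS.
case=> [[o [l1 [l2 [p [uP vP]]]]] | [o [l1 [p1 [l2 [p2 [uP vP [o3 [l3 [p3 uvP]]]]]]]]]].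
  left; exists o, (4 * l1), (4 * l2), (4 * p).
  by split; apply: owned_add_path_old; rewrite //= old_neq_new.
right; exists o, (4 * l1), (4 * p1), (4 * l2), (4 * p2).
split; try by apply: owned_add_path_old; rewrite //= old_neq_new.
exists o3, (4 * l3), (4 * p3).
by apply: owned_add_path_old; rewrite //= !old_neq_new.
Qed.

Lemma represents_add_path (H E H' E' : rel T) :
  represents P S H E -> proper_zpath W -> symmetric E' -> symmetric H' ->
  {in S &, forall x y, E' x y = E x y} ->
  {in S &, forall x y, H' x y -> x != y -> H x y} ->
  {in S, forall x, touch (scale4 (P x)) W <-> E' w x} ->
  {in S, forall x, H' w x -> display P' (w |: S) x w} ->
  (exists o l p, owned P' (w |: S) (pred1 w) o l p) ->
  represents P' (w |: S) H' E'.
Proof.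
case=> Pok PE PH Palone Wok symE symH EE HH touchW dispW Walone; split.
- by move=> x; rewrite /add_path; case: eqP => // _; apply: proper_scale4.
- move=> x y /setU1P[-> | xS] /setU1P[-> | yS]; rewrite ?eqxx // => neq_xy.
  + rewrite add_path_new add_path_old //; split=> [/touch_sym | /(touchW y yS)/touch_sym//].
    by move/(touchW y yS).
  + by rewrite symE add_path_new add_path_old //; apply: touchW.
  rewrite !add_path_old // EE // -PE //; apply: touch_scale4.
- move=> x y /setU1P[-> | xS] /setU1P[-> | yS]; rewrite ?eqxx // => neq_xy Hxy.
  + by apply: display_sym; apply: dispW.
  + by apply: dispW; rewrite // symH.
  by apply: display_add_path; rewrite //; apply: PH; rewrite //; apply: HH.
move=> x /setU1P[-> // | xS].
have [o [l [p xP]]] := Palone x xS; exists o, (4 * l), (4 * p).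
by apply: owned_add_path_old; rewrite //= old_neq_new.
Qed.

End AddPath.

(* The neighbours of the new vertex [w] among the vertices placed so far are the owners
   of one grid edge; the targets [t] are where [w] is to be alone. *)
Lemma represents_attach (T : finType) (P : T -> zpath) (S : {set T}) (w : T)
    (H E H' E' : rel T) (t : bool -> int) :
  represents P S H E -> w \notin S -> symmetric E' -> symmetric H' ->
  {in S &, forall x y, E' x y = E x y} ->
  {in S &, forall x y, H' x y -> x != y -> H x y} ->
  (exists o l p, owned P S (E' w) o l p) \/ {in S, forall x, ~~ E' w x} ->
  {in S, forall x, H' w x -> exists o l, owned P S (pred1 x) o l (t o)} ->
  exists P', represents P' (w |: S) H' E'.
Proof.
move=> rep w_notin symE symH EE HH anchor target.
have [o [b [r [even_b anchorb]]]] : exists o b r, (exists k, b = 2 * k) /\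
    {in S, forall x, covers (scale4 (P x)) o b (4 * r + 1) = E' w x}.
  case: anchor => [[o [l [p AP]]] | noE].
    exists o, (4 * l), p; split; first by exists (2 * l); lia.
    by move=> x xS; rewrite covers_scale4 // AP.
  exists false, 2, 0; split; first by exists 1.
  move=> x xS; rewrite (negPf (noE x xS)); apply: covers_scale4_fresh; lia.
have [W [Wok Wav touchW aloneW]] := attach o r t even_b.
exists (add_path P w W); apply: represents_add_path rep _ _ _ _ _ _ _ _ => //.
- by move=> x xS; rewrite touchW anchorb.
- move=> x xS /(target x xS)[o' [l xP]]; left.
  have [l' [fresh_l' cW]] := aloneW o'.
  exists o', (4 * l), l', (4 * t o'); split.
    by apply: owned_add_path_old; rewrite //= (old_neq_new w_notin).
  exact: owned_add_path_new.
have [l [fresh_l cW]] := aloneW false.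
by exists false, l, (4 * t false); apply: owned_add_path_new.
Qed.

(** Each facing edge gives a crossing display with [w]: its first piece stays with the old owner,
    its second piece is shared with [w] only, and the perpendicular joining segment belongs to [w]
    alone. *)
Lemma represents_bridge (T : finType) (P : T -> zpath) (S : {set T}) (w u v : T)
    (H E H' E' : rel T) :
  represents P S H E -> w \notin S -> symmetric E' -> symmetric H' ->
  {in S &, forall x y, E' x y = E x y} ->
  {in S &, forall x y, H' x y -> x != y -> H x y} ->
  u \in S -> v \in S -> u != v -> parallel_display P S u v ->
  {in S, E' w =1 pred2 u v} -> {in S, forall x, H' w x -> x \in pred2 u v} ->
  exists P', represents P' (w |: S) H' E'.
Proof.
move=> rep w_notin symE symH EE HH uS vS neq_uv [o [l1 [l2 [p [uP vP]]]]] Ew Hw.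
have neq_l : l1 <> l2.
  by move=> El; move: (uP u uS) (vP u uS); rewrite El => -> /=; rewrite eqxx (negPf neq_uv).
have [W [Wok Wav touchW /andP[cW1 cW2] [l [s [fresh_l cWl]]]]] := bridge o p neq_l.
have Walone : owned (add_path P w W) (w |: S) (pred1 w) (~~ o) l s.
  exact: owned_add_path_new.
have disp x l' : x \in S -> owned P S (pred1 x) o l' p ->
    covers W o (4 * l') (4 * p + 1) -> display (add_path P w W) (w |: S) x w.
  move=> xS xP cW; right.
  exists o, (4 * l'), (4 * p), l, s; split=> //.
    by apply: owned_add_path_old; rewrite //= (old_neq_new w_notin).
  exists o, (4 * l'), (4 * p + 1) => y /setU1P[-> | yS].
    by rewrite add_path_new cW /= eqxx orbT.
  rewrite (add_path_old _ _ w_notin) // covers_scale4 // xP //=.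
  by rewrite [y == w]eq_sym (old_neq_new w_notin yS) ?orbF.
exists (add_path P w W); apply: represents_add_path rep _ _ _ _ _ _ _ _ => //.
- by move=> x xS; rewrite touchW uP // vP // Ew.
- by move=> x xS /(Hw x xS) /pred2P[->|->]; [apply: disp cW1 | apply: disp cW2].
by exists (~~ o), l, s.
Qed.

(** [N] stands for the placed vertices of the current bag. The cases follow its size and the
    adjacencies of [w]; a bridge is called for only if [w] is adjacent to two vertices whose display
    is parallel. *)
Lemma represents_extend (T : finType) (P : T -> zpath) (S N : {set T}) (w : T)
    (H E H' E' : rel T) :
  represents P S H E -> w \notin S -> symmetric E' -> symmetric H' ->
  {in S &, forall x y, E' x y = E x y} ->
  {in S &, forall x y, H' x y -> x != y -> H x y} ->
  N \subset S -> (#|N| <= 2)%N -> {in N &, forall x y, x != y -> H x y} ->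
  {in S, forall x, H' w x -> x \in N} -> {in S, forall x, E' w x -> x \in N} ->
  exists P', represents P' (w |: S) H' E'.
Proof.
move=> rep w_notin symE symH EE HH NS cardN cliqueN Hw Ew.
have [_ _ Pdisp Palone] := rep.
have [N0 | [u Nu]] := set_0Vmem N.
  apply: (represents_attach (t := fun=> 0)) rep _ _ _ _ _ _ _ => //.
    by right=> x xS; apply/negP=> /(Ew x xS); rewrite N0 inE.
  by move=> x xS /(Hw x xS); rewrite N0 inE.
have uS := subsetP NS u Nu.
have [v0 | [v]] := set_0Vmem (N :\ u).
  have{v0} NE : N = [set u] by rewrite -(setD1K Nu) v0 setU0.
  have [o [l [p uP]]] := Palone u uS.
  apply: (represents_attach (t := fun=> p)) rep _ _ _ _ _ _ _ => //.
    case Ewu : (E' w u); [left | right].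
      exists o, l, p => x xS; rewrite uP //=.
      by apply/eqP/idP=> [-> // | /(Ew x xS)]; rewrite NE inE => /eqP.
    by move=> x xS; apply/negP=> Ex; move: (Ew x xS Ex);
      rewrite NE inE => /eqP Exu; rewrite -Exu Ex in Ewu.
  by move=> x xS /(Hw x xS); rewrite NE inE => /eqP->; exists o, l.
rewrite !inE => /andP[neq_vu Nv]; have vS := subsetP NS v Nv.
have NE : N = [set u; v].
  by apply/esym/eqP; rewrite eqEcard cards2 eq_sym neq_vu cardN subUset !sub1set Nu Nv.
have {}Ew x : x \in S -> E' w x = ((x == u) && E' w u) || ((x == v) && E' w v).
  move=> xS; have [-> | neq_xu] := eqVneq x u.
    by rewrite [u == v]eq_sym (negPf neq_vu) orbF.
  have [-> // | neq_xv] := eqVneq x v; apply/negP=> /(Ew x xS).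
  by rewrite NE !inE (negPf neq_xu) (negPf neq_xv).
have {}Hw x : x \in S -> H' w x -> x = u \/ x = v.
  by move=> xS /(Hw x xS); rewrite NE => /set2P.
have Huv : display P S u v by apply: Pdisp; rewrite 1?eq_sym //; apply: cliqueN; rewrite // eq_sym.
(* Both kinds of display provide edges owned by u alone and by v alone that [represents_attach]
   can aim at simultaneously, since the new path is alone in both orientations. *)
have [t [[ou [lu uP]] [ov [lv vP]]]] : exists t : bool -> int,
    (exists o l, owned P S (pred1 u) o l (t o)) /\ (exists o l, owned P S (pred1 v) o l (t o)).
  case: Huv => [[o [l1 [l2 [p [uP vP]]]]] | [o [l1 [p1 [l2 [p2 [uP vP _]]]]]]].
    by exists (fun=> p); split; [exists o, l1 | exists o, l2].
  exists (fun o' => if o' == o then p1 else p2); split.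
    by exists o, l1; rewrite eqxx.
  by exists (~~ o), l2; case: (o) vP.
have target : {in S, forall x, H' w x -> exists o l, owned P S (pred1 x) o l (t o)}.
  by move=> x xS /(Hw x xS)[->|->]; [exists ou, lu | exists ov, lv].
case Ewu: (E' w u); case Ewv: (E' w v); last first.
- apply: (represents_attach (t := t)) rep _ _ _ _ _ _ _ => //.
  by right=> x xS; rewrite Ew // Ewu Ewv !andbF.
- apply: (represents_attach (t := t)) rep _ _ _ _ _ _ _ => //.
  by left; exists ov, lv, (t ov) => x xS; rewrite vP // Ew // Ewu Ewv andbF andbT.
- apply: (represents_attach (t := t)) rep _ _ _ _ _ _ _ => //.
  by left; exists ou, lu, (t ou) => x xS; rewrite uP // Ew // Ewu Ewv andbF andbT orbF.
have Ew2 : {in S, E' w =1 pred2 u v} by move=> x xS; rewrite Ew // Ewu Ewv !andbT.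
(* A crossing display supplies an edge owned by exactly [u] and [v] to start from; a parallel one
   promises no such edge. *)
case: Huv => [par | [o [_ [_ [_ [_ [_ _ [o3 [l3 [p3 uvP]]]]]]]]]].
  apply: represents_bridge rep _ _ _ _ _ uS vS _ par _ _ => //; first by rewrite eq_sym.
  by move=> x xS /(Hw x xS) Ex; apply/pred2P.
apply: (represents_attach (t := t)) rep _ _ _ _ _ _ _ => //.
by left; exists o3, l3, p3 => x xS; rewrite uvP // Ew2.
Qed.

(** * Paths in trees *)

Lemma path_exit (T : finType) (e : rel T) (X : {set T}) x y :
  connect e x y -> x \in X -> y \notin X ->
  exists i j, [/\ i \in X, j \notin X & e i j].
Proof.
case/connectP=> p; elim: p x => [|z p IHp] x /=.
  by move=> _ -> xX; rewrite xX.
case/andP=> exz pathp Ey xX yX; case zX: (z \in X); first exact: IHp Ey zX yX.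
by exists x, z; rewrite zX.
Qed.

Definition induced (T : finType) (e : rel T) (X : {set T}) : rel T :=
  [rel a b | [&& e a b, a \in X & b \in X]].

Lemma path_induced (T : finType) (e : rel T) (X : {set T}) x p :
  path (induced e X) x p -> path e x p /\ {subset p <= X}.
Proof.
elim: p x => [|y p IHp] x //= /andP[/and3P[exy xX yX] /IHp[pathp pX]].
rewrite exy pathp; split=> // z; rewrite inE => /predU1P[-> // | ]; exact: pX.
Qed.

(* If [i] were not on the path, its part up to the first node of [X], continued inside [X]
   to [i] and back to [j], would be a cycle. *)
Lemma tree_path_entry (D : sgraph) (X : {set D}) (i j : D) (p : seq D) :
  is_tree D -> {in X &, forall x y, connect (induced sedge X) x y} ->
  i \in X -> j \notin X -> sedge i j -> path sedge j p -> last j p \in X ->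
  i \in p.
Proof.
move=> [_ _ acyclic] connX iX jX eij pathp lastX; apply/negPn/negP=> ip.
have hasX : has [in X] p.
  case: p pathp lastX {ip} => [|x p] _ /=; first by rewrite (negPf jX).
  by move=> lX; rewrite -/(has _ (x :: p)); apply/hasP; exists (last x p); rewrite ?mem_last.
case/split_find: hasX pathp ip {lastX} => m p1 p2 mX p1X.
rewrite cat_path mem_cat negb_or => /andP[pathp1 _] /andP[ip1 _].
have := last_rcons j p1 m; case/shortenP: pathp1 => p' pathp' uniqp' subp' lastp'.
have neq_mi : m != i by apply: contraNneq ip1 => <-; rewrite mem_rcons mem_head.
have [q0 pathq0 lastq0] := connectP (connX m i mX iX).
case/shortenP: pathq0 lastq0 => q /path_induced[pathq qX] uniqq _ lastq.
have := acyclic (j :: p' ++ q); rewrite /ucycle /= => /(_ _)/wrap[].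
  rewrite rcons_cat cat_path pathp' lastp' rcons_path pathq -lastq eij /=.
  move: uniqp' uniqq => /= /andP[jp' uniqp'] /andP[mq uniqq].
  rewrite mem_cat negb_or jp' cat_uniq uniqp' uniqq /= andbT.
  apply/andP; split; first by apply: contra jX => /qX.
  apply/hasPn=> x xq; apply/negP=> xp'; have := subp' x xp'.
  rewrite mem_rcons inE => /predU1P[xm | xp1]; first by rewrite -xm xq in mq.
  by move/hasPn/(_ x xp1): p1X; rewrite /= qX.
(* Neither [p'] nor [q] is empty, since [m] differs from [j] and from [i]; together with [j] the
   cycle has at least three nodes. *)
case: p' lastp' {pathp' uniqp' subp'} => [/= jm|? ? _]; first by rewrite -jm (negPf jX) in mX.
case: q lastq {pathq qX uniqq} => [/= Eim|? ? _]; first by rewrite Eim eqxx in neq_mi.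
by rewrite /= size_cat /= addnS.
Qed.

Lemma represents_sub (T : finType) (P : T -> zpath) (S : {set T}) (H E H' E' : rel T) :
  represents P S H E -> {in S &, forall x y, H' x y -> x != y -> H x y} ->
  {in S &, forall x y, E' x y = E x y} -> represents P S H' E'.
Proof.
case=> Pok PE PH Palone HH EE; split=> // x y xS yS neq_xy; first by rewrite EE //; apply: PE.
by move=> Hxy; apply: PH => //; apply: HH.
Qed.

(** * Traversal of the tree decomposition *)

Section TreeDecomposition.

Variables (G D : sgraph) (B : D -> {set G}).
Hypothesis decB : tree_decomposition B.
Hypothesis cardB : forall i, (#|B i| <= 3)%N.

Definition covered (X : {set D}) : {set G} := \bigcup_(i in X) B i.

Definition cobag (X : {set D}) : rel G :=
  [rel u v | [exists i in X, (u \in B i) && (v \in B i)]].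

(** Only edges inside a processed bag count; on the whole tree this gives back [sedge], since every
    edge lies in some bag. *)
Definition cobag_edge (X : {set D}) : rel G := [rel u v | sedge u v && cobag X u v].

Lemma cobag_sym X : symmetric (cobag X).
Proof. by move=> u v; apply: eq_existsb => i; rewrite [(u \in _) && _]andbC. Qed.

Lemma cobag_covered X u v : cobag X u v -> u \in covered X.
Proof. by case/exists_inP=> i iX /andP[uB _]; apply/bigcupP; exists i. Qed.

(** Nodes whose bags contain [v] form a path from [j] into [X], and such a path passes through [i].
    Hence the placed vertices of a new bag all lie in one processed bag. *)
Lemma bag_intersection (X : {set D}) i j v : {in X &, forall x y, connect (induced sedge X) x y} ->
  i \in X -> j \notin X -> sedge i j -> v \in B j -> v \in covered X -> v \in B i.
Proof.
move=> connX iX jX eij vj /bigcupP[k kX vk]; have [treeD _ _ conn_bags] := decB.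
have /connectP[p pathp lastp] := conn_bags v j k vj vk.
have [pathDp pB] : path sedge j p /\ {subset p <= [set a | v \in B a]}.
  by apply: path_induced; apply: sub_path pathp => a b; rewrite /induced /= !inE.
suff /pB : i \in p by rewrite inE.
by apply: tree_path_entry treeD connX iX jX eij pathDp _; rewrite -lastp.
Qed.

(** The missing vertices of the bag are placed one by one. A new [w] is in no processed bag, so its
    partners lie in the part [A] of the new bag already placed, and [A] has at most two elements
    because [w] occupies a third place. *)
Lemma represents_add_bag X j :
  {in B j :&: covered X &, forall u v, cobag X u v} ->
  (exists P, represents P (covered X) (cobag X) (cobag_edge X)) ->
  exists P, represents P (covered (j |: X)) (cobag (j |: X)) (cobag_edge (j |: X)).
Proof.
move=> A0H [P0 rep0].
pose H (A : {set G}) : rel G := [rel u v | cobag X u v || (u \in A) && (v \in A)].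
pose E (A : {set G}) : rel G := [rel u v | sedge u v && H A u v].
have symH A : symmetric (H A) by move=> u v; rewrite /H /= cobag_sym [(u \in A) && _]andbC.
have symE A : symmetric (E A) by move=> u v; rewrite /E /= sedge_sym -/(H A u v) symH.
have HBj u v : cobag (j |: X) u v = H (B j) u v.
  apply/exists_inP/orP=> [[i /setU1P[-> | iX] uvi] | [/exists_inP[i iX uvi] | uvj]].
  - by right.
  - by left; apply/exists_inP; exists i.
  - by exists i; rewrite // setU1r.
  by exists j; rewrite ?setU11.
suff [P rep] : exists P, represents P (covered X :|: B j) (H (B j)) (E (B j)).
  have -> : covered (j |: X) = covered X :|: B j.
    by rewrite /covered bigcup_setU big_set1 setUC.
  exists P; apply: represents_sub rep _ _ => u v _ _; first by rewrite HBj.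
  by rewrite /E /cobag_edge /= HBj.
suff grow n : forall A : {set G}, #|B j :\: A| = n ->
    B j :&: covered X \subset A -> A \subset B j ->
    (exists P, represents P (covered X :|: A) (H A) (E A)) ->
    exists P, represents P (covered X :|: B j) (H (B j)) (E (B j)).
  apply: (grow _ (B j :&: covered X)) => //; first exact: subsetIl.
  rewrite (setUidPl _) ?subsetIr //; exists P0; apply: represents_sub rep0 _ _.
    by move=> u v _ _ /orP[//|/andP[uA vA]] _; apply: A0H.
  move=> u v _ _; rewrite /E /H /cobag_edge /=; congr (_ && _).
  by apply: orb_idr => /andP[uA vA]; apply: A0H.
elim: n => [|n IHn] A cardA A0A Aj [P rep].
  have -> : B j = A; last by exists P.
  by apply/eqP; rewrite eqEsubset Aj andbT -setD_eq0 -cards_eq0 cardA.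
have [w] : exists w, w \in B j :\: A by apply/card_gt0P; rewrite cardA.
rewrite inE => /andP[wA wj].
have w_notin : w \notin covered X.
  by apply: contra wA => wX; apply: (subsetP A0A); rewrite inE wj.
have notw x : x \in covered X :|: A -> (x == w) = false.
  by move=> xS; apply/eqP=> xw; move: xS; rewrite xw inE (negPf wA) (negPf w_notin).
have Hw x : x \in covered X :|: A -> H (w |: A) w x -> x \in A.
  move=> xS /orP[/cobag_covered | /andP[_]]; first by rewrite (negPf w_notin).
  by rewrite !inE notw.
have Hold x y : x \in covered X :|: A -> y \in covered X :|: A -> H (w |: A) x y = H A x y.
  by move=> xS yS; rewrite /H /= !inE !notw.
apply: (IHn (w |: A)).
- have := cardsD1 w (B j :\: A); rewrite inE wA wj cardA add1n => -[->].
  by congr #|pred_of_set _|; rewrite setUC setDDl.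
- exact: subset_trans A0A (subsetUr _ _).
- by rewrite subUset sub1set wj.
rewrite setUCA.
apply: (represents_extend (N := A)) rep _ _ _ _ _ _ _ _ _ _ => //.
- by rewrite inE negb_or w_notin.
- by move=> x y xS yS; rewrite /E /= -!/(H _ _ _) Hold.
- by move=> x y xS yS; rewrite Hold.
- exact: subsetUr.
- by have := leq_trans (subset_leq_card (_ : w |: A \subset B j)) (cardB j);
    rewrite cardsU1 wA subUset sub1set wj Aj => /(_ isT).
- by move=> x y xA yA _; rewrite /H /= xA yA orbT.
by move=> x xS /andP[_]; apply: Hw.
Qed.

(** Induction on the number of unprocessed nodes, with the processed ones kept connected; each new
    node is adjacent to a processed one, except the first. *)
Lemma represents_decomposition : exists P : G -> zpath, represents P setT (fun _ _ => false) sedge.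
Proof.
have [treeD cover_vertex cover_edge _] := decB.
have [D_gt0 connD _] := treeD.
suff grow n : forall X : {set D}, #|~: X| = n ->
    {in X &, forall x y, connect (induced sedge X) x y} ->
    (exists P, represents P (covered X) (cobag X) (cobag_edge X)) ->
    exists P, represents P (covered setT) (cobag setT) (cobag_edge setT).
  have [||P rep] := grow _ set0 erefl.
  - by move=> x y; rewrite inE.
  - have cov0 : covered set0 = set0 by rewrite /covered big_set0.
    (* Before any vertex is placed, any proper polyline serves as placeholder; this one is a single
       vertical edge. *)
    exists (fun=> ZPath false 0 0 0 1 0); rewrite cov0.
    by split=> // x; rewrite ?inE // => y; rewrite inE.
  exists P.
  have covT : covered setT = setT.
    by apply/setP=> v; have [i vi] := cover_vertex v; rewrite inE; apply/bigcupP; exists i.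
  rewrite -covT; apply: represents_sub rep _ _ => // u v _ _.
  rewrite /cobag_edge /=; case euv: (sedge u v) => //=.
  by have [i uvi] := cover_edge u v euv; apply/esym/exists_inP; exists i.
elim: n => [|n IHn] X cardX connX rep.
  have <- // : X = setT by rewrite -[X]setCK (cards0_eq cardX) setC0.
have [X0 | [x0 x0X]] := set_0Vmem X.
  have [j _] := card_gt0P D_gt0.
  apply: (IHn (j |: X)).
  - by move: cardX; rewrite X0 setU0 setC0 cardsT cardsC1 => ->.
  - by move=> x y; rewrite X0 setU0 => /set1P-> /set1P->.
  apply: represents_add_bag rep => u v.
  by rewrite X0 /covered big_set0 setI0 inE.
have [y0 y0X] : exists y0, y0 \in ~: X by apply/card_gt0P; rewrite cardX.
rewrite inE in y0X.
have [i [j [iX jX eij]]] := path_exit (connD x0 y0) x0X y0X.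
apply: (IHn (j |: X)).
- have := cardsD1 j (~: X); rewrite cardX inE jX add1n => -[->].
  by congr #|pred_of_set _|; apply/setP=> x; rewrite !inE negb_or.
- have connX' : {in X &, forall x y, connect (induced sedge (j |: X)) x y}.
    move=> x y xX yX; apply: connect_sub (connX x y xX yX) => a b /and3P[eab aX bX].
    by apply: connect1; rewrite /induced /= eab !setU1r.
  have eij' : connect (induced sedge (j |: X)) i j.
    by apply: connect1; rewrite /induced /= eij setU11 setU1r.
  have eji' : connect (induced sedge (j |: X)) j i.
    by apply: connect1; rewrite /induced /= sedge_sym eij setU11 setU1r.
  move=> x y /setU1P[-> | xX] /setU1P[-> | yX] //; last exact: connX'.
    exact: connect_trans eji' (connX' i y iX yX).
  exact: connect_trans (connX' x i xX iX) eij'.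
apply: represents_add_bag rep => u v /setIP[uj uX] /setIP[vj vX].
by apply/exists_inP; exists i => //; rewrite !(bag_intersection connX iX jX eij).
Qed.

End TreeDecomposition.

(** * From polylines to grid paths *)

Definition edge_code (s : point * point) : bool * int * int :=
  if horizontal s then (false, s.1.2, if s.1.1 <= s.2.1 then s.1.1 else s.2.1)
  else (true, s.1.1, if s.1.2 <= s.2.2 then s.1.2 else s.2.2).

Definition shift (o : bool) (k : int) (p : point) : point :=
  if o then (p.1, p.2 + k) else (p.1 + k, p.2).

Definition along (o : bool) (p : point) : int := if o then p.2 else p.1.
Definition across (o : bool) (p : point) : int := if o then p.1 else p.2.

(* A unit step [(o, s)]: vertical iff [o], in the positive direction iff [s]. *)
Definition step (p : point) (d : bool * bool) : point :=
  shift d.1 (if d.2 then 1 else - 1) p.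

Definition trace (p : point) (ds : seq (bool * bool)) : seq point :=
  p :: scanl step p ds.

Definition trace_codes (p : point) (ds : seq (bool * bool)) :=
  map edge_code (consecutive (trace p ds)).

Lemma horizontal_step p d : horizontal (p, step p d) = ~~ d.1.
Proof.
by case: p d => x y [[] []]; rewrite /horizontal /step /=; lia.
Qed.

Lemma vertical_step p d : vertical (p, step p d) = d.1.
Proof.
by case: p d => x y [[] []]; rewrite /vertical /step /=; lia.
Qed.

Lemma edge_code_step p d : edge_code (p, step p d) =
  (d.1, across d.1 p, if d.2 then along d.1 p else along d.1 p - 1).
Proof.
rewrite /edge_code horizontal_step.
by case: p d => x y [[] []] /=; case: ifP => ?; congr (_, _, _); lia.
Qed.

Lemma grid_edgeP s : is_grid_edge s -> exists p d, s = (p, step p d).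
Proof.
case: s => [[x1 y1] [x2 y2]] /orP[] /andP[/= /eqP-> Ex].
  exists (x1, y2), (false, x1 < x2); rewrite /step /shift /=.
  by congr (_, (_, _)); case: ifP; lia.
exists (x2, y1), (true, y1 < y2); rewrite /step /shift /=.
by congr (_, (_, _)); case: ifP; lia.
Qed.

(** The code forgets the direction of traversal and keeps the orientation, the line and the smaller
    end, which are the coordinates used by [covers]. *)
Lemma same_edge_code s t : is_grid_edge s -> is_grid_edge t ->
  same_edge s t = (edge_code s == edge_code t).
Proof.
move=> /grid_edgeP[p [d ->]] /grid_edgeP[q [e ->]]; rewrite !edge_code_step /same_edge.
case: p d q e => [x1 y1] [[] []] [x2 y2] [[] []];
  by rewrite /step /shift !xpair_eqE /=; lia.
Qed.

Lemma consecutive_trace p d ds :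
  consecutive (trace p (d :: ds)) = (p, step p d) :: consecutive (trace (step p d) ds).
Proof. by []. Qed.

Lemma trace_grid_edges p ds : all is_grid_edge (consecutive (trace p ds)).
Proof.
elim: ds p => // d ds IHds p; rewrite consecutive_trace /= IHds.
by rewrite /is_grid_edge horizontal_step vertical_step; case: d.1.
Qed.

Lemma grid_path_trace p ds : (0 < size ds)%N -> uniq (trace_codes p ds) ->
  grid_path (trace p ds).
Proof.
move=> ds_gt0 uniq_codes; rewrite /grid_path trace_grid_edges /= size_scanl ltnS ds_gt0 /=.
have := trace_grid_edges p ds; move: uniq_codes; rewrite /trace_codes.
elim: (consecutive _) => //= s es IHes /andP[s_notin uniq_es] /andP[gs ges].
rewrite IHes // andbT; apply/allP=> t tes.
rewrite (same_edge_code gs (allP ges t tes)); apply: contraNneq s_notin => ->.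
exact: map_f.
Qed.

Lemma share_edge_trace p ds q es : share_edge (trace p ds) (trace q es) <->
  exists o l x, ((o, l, x) \in trace_codes p ds) && ((o, l, x) \in trace_codes q es).
Proof.
split=> [/hasP[s sP /hasP[t tQ]] | [o [l [x /andP[/mapP[s sP Es] /mapP[t tQ Et]]]]]].
  rewrite (same_edge_code (allP (trace_grid_edges _ _) _ sP)
    (allP (trace_grid_edges _ _) _ tQ)).
  move/eqP; case Es: (edge_code s) => [[o l] x] Et.
  by exists o, l, x; apply/andP; split; apply/mapP; [exists s | exists t].
apply/hasP; exists s => //; apply/hasP; exists t => //.
by rewrite (same_edge_code (allP (trace_grid_edges _ _) _ sP)
    (allP (trace_grid_edges _ _) _ tQ)) -Es -Et.
Qed.

Definition turns (ds : seq (bool * bool)) : nat :=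
  count (fun dd => dd.1.1 != dd.2.1) (consecutive ds).

Lemma bends_trace p ds : bends (trace p ds) = turns ds.
Proof.
rewrite /bends /turns; case: ds p => // d ds p; elim: ds d p => // d' ds IHds d p.
move: (IHds d' (step p d)); rewrite !consecutive_trace /consecutive /= => ->.
rewrite /is_bend /= !horizontal_step !vertical_step /=.
by case: d.1 d'.1 => [] [].
Qed.

(** A straight run can add a turn only at its junction with [ds]. *)
Lemma turns_nseq_cat n o s ds :
  (turns (nseq n (o, s) ++ ds) <= (turns ds).+1)%N.
Proof.
case: n => [|n]; first exact: leqnSn.
elim: n => [|n IHn]; last by rewrite /turns /consecutive /= eqxx in IHn *.
by case: ds => // d ds; rewrite /turns /consecutive /= -add1n leq_add2r leq_b1.
Qed.

Definition run (o : bool) (k : int) : seq (bool * bool) := nseq `|k|%N (o, 0 <= k).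

Lemma turns_run3 o1 k1 o2 k2 o3 k3 :
  (turns (run o1 k1 ++ run o2 k2 ++ run o3 k3) <= 2)%N.
Proof.
do 2!apply: leq_trans (turns_nseq_cat _ _ _ _) _; rewrite !ltnS.
by rewrite /run; case: `|k3|%N => // n; elim: n => // n; rewrite /turns /consecutive /= eqxx.
Qed.

Lemma trace_codes_cat p ds es :
  trace_codes p (ds ++ es) = trace_codes p ds ++ trace_codes (foldl step p ds) es.
Proof.
elim: ds p => // d ds IHds p.
by rewrite /trace_codes cat_cons !consecutive_trace /= -[map _ _]/(trace_codes _ _) IHds.
Qed.

Lemma foldl_run p o k : foldl step p (run o k) = shift o k p.
Proof.
have nseqE n s : foldl step p (nseq n (o, s)) = shift o (if s then n%:Z else - n%:Z) p.
  elim: n p => [|n IHn] [x y] /=.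
    by rewrite /shift; case: (s); case: (o) => /=; congr (_, _); lia.
  by rewrite IHn /step /shift; case: (s); case: (o) => /=; congr (_, _); lia.
by rewrite nseqE; congr shift; case: ifP; lia.
Qed.

Lemma trace_codes_run p o k o' l q : ((o', l, q) \in trace_codes p (run o k)) =
  [&& o' == o, l == across o p & between (along o p) (along o p + k) q].
Proof.
have nseqE n s : ((o', l, q) \in trace_codes p (nseq n (o, s))) =
    [&& o' == o, l == across o p
      & between (along o p) (along o p + (if s then n%:Z else - n%:Z)) q].
  elim: n p => [|n IHn] p0.
    rewrite /between in_nil; case: s => /=; case: (_ == o) => //; case: (l == _) => //=; lia.
  rewrite /trace_codes consecutive_trace map_cons in_cons -/(trace_codes _ _) IHn.
  rewrite edge_code_step !xpair_eqE /between /=; case: (eqVneq o' o) => //= _.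
  by case: p0 {IHn} => x y; rewrite /step /shift /across /along; case: o; case: s => /=; lia.
by rewrite nseqE; do 2!congr (_ && _); congr between; case: ifP; lia.
Qed.

Lemma uniq_trace_codes_run p o k : uniq (trace_codes p (run o k)).
Proof.
rewrite /run; elim: `|k|%N (0 <= k) p => // n IHn s p.
rewrite -[nseq _.+1 _]/(_ :: nseq n _) /trace_codes consecutive_trace map_cons cons_uniq.
rewrite -/(trace_codes _ _) IHn andbT edge_code_step.
(* For [n = 0] the sign [s] is lost, harmlessly, as the run is empty. *)
have -> : nseq n (o, s) = run o (if s then n%:Z else - n%:Z).
  case: n {IHn} => [|n]; first by case: s.
  by rewrite /run; case: s; congr nseq; try congr (_, _); lia.
rewrite trace_codes_run /between /=.
by case: p {IHn} => x y; rewrite /step /shift /across /along; case: o; case: s => /=; lia.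
Qed.

Definition zpath_start (Q : zpath) : point :=
  if zor Q then (zb Q, za Q) else (za Q, zb Q).

Definition zpath_steps (Q : zpath) : seq (bool * bool) :=
  run (zor Q) (zc Q - za Q) ++ run (~~ zor Q) (zd Q - zb Q) ++ run (zor Q) (ze Q - zc Q).

Definition grid_of_zpath (Q : zpath) : seq point := trace (zpath_start Q) (zpath_steps Q).

Lemma covers_grid Q o l p :
  ((o, l, p) \in trace_codes (zpath_start Q) (zpath_steps Q)) = covers Q o l p.
Proof.
rewrite !trace_codes_cat !mem_cat !foldl_run !trace_codes_run.
rewrite /covers /between /zpath_start /shift /along /across.
case: Q => [oQ a b c d e] /=; case: o; case: oQ => /=; lia.
Qed.

(** The outer runs lie on the distinct lines [zb Q] and [zd Q], and the middle run has the other
    orientation. *)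
Lemma uniq_zpath_codes Q : proper_zpath Q ->
  uniq (trace_codes (zpath_start Q) (zpath_steps Q)).
Proof.
move=> properQ; rewrite !trace_codes_cat !cat_uniq !uniq_trace_codes_run !andbT /=.
apply/andP; split; apply/hasPn=> -[[o l] p]; rewrite ?mem_cat !foldl_run !trace_codes_run;
  move: properQ; rewrite /proper_zpath /between /zpath_start /shift /along /across;
  by case: Q => [oQ a b c d e] /=; case: o; case: oQ => /=; lia.
Qed.

Lemma bend_graph2_of_touch (G : sgraph) (P : G -> zpath) :
  (forall x, proper_zpath (P x)) ->
  (forall x y, x != y -> touch (P x) (P y) <-> sedge x y) -> bend_graph 2 G.
Proof.
move=> Pok PE; exists (grid_of_zpath \o P); split; last first.
  by move=> u; rewrite /= bends_trace turns_run3.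
split=> [u | u v neq_uv] /=.
  apply: grid_path_trace (uniq_zpath_codes (Pok u)).
  by have := Pok u; rewrite /proper_zpath /zpath_steps /run !size_cat !size_nseq; lia.
apply/idP/idP=> [/share_edge_trace | /(PE u v neq_uv)] [o [l [p uvP]]].
  by apply/(PE u v neq_uv); exists o, l, p; rewrite -!covers_grid.
by apply/share_edge_trace; exists o, l, p; rewrite !covers_grid.
Qed.

Local Close Scope ring_scope.

Theorem theorem1 (G : sgraph) (t : nat) :
  is_treewidth G t -> t <= 2 ->
  (exists2 b, is_bend_number G b & b <= 2) /\ bend_graph 2 G.
Proof.
case=> -[D [B [decB widthB]]] _ le_t2.
have cardB i : (#|B i| <= 3)%N.
  (* The predecessor in [width] truncates only when all bags are empty, and then the bound 3 holds
     as well. *)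
  have := leq_bigmax (F := fun i => #|B i|) i; move: widthB le_t2; rewrite /width.
  lia.
have [P [Pok PE _ _]] := represents_decomposition decB cardB.
have G2 : bend_graph 2 G by apply: bend_graph2_of_touch Pok _ => x y; apply: PE; rewrite inE.
split=> //.
(* [bend_graph] is not given by a boolean test, so the least bend count is found by excluded middle
   at 0 and 1. *)
have [G0 | nG0] := classic (bend_graph 0 G); first by exists 0%N.
have [G1 | nG1] := classic (bend_graph 1 G).
  by exists 1%N => //; split=> // -[].
by exists 2%N => //; split=> // -[|[]].
Qed.
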